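(* Let a proper element $q\in L$ be $\phi$-$\delta$-primary. If $q^2\not\leqslant \phi(q)$, then $q$ is $\delta$-primary.
   Context: A multiplicative lattice is a complete lattice (least element $0$, greatest element $1$) with a commutative, associative multiplication that distributes over arbitrary joins and for which $1$ is the identity. An element $a$ is compact if $a\leqslant \bigvee X$ with $X\subseteq L$ implies $a\leqslant a_1\vee\dots\vee a_n$ for finitely many $a_i\in X$; $L$ is compactly generated if every element is a join of compact elements. Standing assumptions: $L$ is a compactly generated multiplicative lattice in which $1$ is compact and every finite product of compact elements is compact; $\delta:L\to L$ is an expansion function, i.e. $a\leqslant\delta(a)$ for all $a$, and $a\leqslant b$ implies $\delta(a)\leqslant\delta(b)$; $\phi:L\to L$ is a function with $\phi(a)\leqslant a$ for all $a$. An element $p$ is proper if $p<1$. A proper element $p$ is $\delta$-primary if for all $a,b\in L$, $ab\leqslant p$ implies $a\leqslant p$ or $b\leqslant\delta(p)$; it is $\phi$-$\delta$-primary if for all $a,b\in L$, $ab\leqslant p$ and $ab\not\leqslant\phi(p)$ implies $a\leqslant p$ or $b\leqslant\delta(p)$. *)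

(* Defs.v *)
From HB Require Import structures.
From mathcomp Require Import all_boot all_order.
From mathcomp Require Import boolp classical_sets.

Set Implicit Arguments.
Unset Strict Implicit.
Unset Printing Implicit Defensive.

Import Order.TTheory.

Local Open Scope classical_set_scope.
Local Open Scope order_scope.

(* Completeness is given by a join operation on arbitrary subsets; arbitrary
   meets are then joins of lower bounds. The least element 0 is written \bot
   and the greatest element 1 is written \top. *)
HB.mixin Record TBLattice_isComplete (d : Order.disp_t) (L : Type)
    of Order.TBLattice d L := {
  bigjoin : set L -> L;
  bigjoinP : forall X : set L, supremums X (bigjoin X)
}.

#[short(type="completeLatticeType")]
HB.structure Definition CompleteLattice (d : Order.disp_t) :=
  { L of Order.TBLattice d L & TBLattice_isComplete d L }.

HB.mixin Record CompleteLattice_isMult (d : Order.disp_t) (L : Type)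
    of CompleteLattice d L := {
  mlmul : L -> L -> L;
  mlmulA : associative mlmul;
  mlmulC : commutative mlmul;
  mlmul1x : left_id \top mlmul;
  mlmul_bigjoin : forall (a : L) (X : set L),
    mlmul a (bigjoin X) = bigjoin [set mlmul a x | x in X]
}.

#[short(type="multLatticeType")]
HB.structure Definition MultLattice (d : Order.disp_t) :=
  { L of CompleteLattice d L & CompleteLattice_isMult d L }.

Declare Scope mult_lattice_scope.
Delimit Scope mult_lattice_scope with ML.
Notation "x * y" := (mlmul x y) : mult_lattice_scope.
Notation "x ^+ n" := (iterop n mlmul x \top) : mult_lattice_scope.

Local Open Scope mult_lattice_scope.

(* The empty join is allowed as a finite subjoin, so \bot is compact. *)
Definition compact_elt (d : Order.disp_t) (L : completeLatticeType d) (a : L) :=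
  forall X : set L, a <= bigjoin X ->
    exists2 s : seq L, [set` s] `<=` X & a <= \join_(x <- s) x.

Definition compactly_generated (d : Order.disp_t) (L : completeLatticeType d) :=
  forall a : L, exists2 X : set L, X `<=` @compact_elt d L & a = bigjoin X.

Definition compact_prod_closed (d : Order.disp_t) (L : multLatticeType d) :=
  forall s : seq L, [set` s] `<=` @compact_elt d L ->
    compact_elt (\big[mlmul / \top]_(x <- s) x).

Definition expansion_function (d : Order.disp_t) (L : multLatticeType d)
    (delta : L -> L) :=
  (forall a, a <= delta a) /\ {homo delta : a b / a <= b}.

Definition proper_elt (d : Order.disp_t) (L : multLatticeType d) (p : L) : Prop :=
  p < \top.

Definition delta_primary (d : Order.disp_t) (L : multLatticeType d)
    (delta : L -> L) (p : L) :=
  proper_elt p /\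
  forall a b : L, a * b <= p -> a <= p \/ b <= delta p.

Definition phi_delta_primary (d : Order.disp_t) (L : multLatticeType d)
    (phi delta : L -> L) (p : L) :=
  proper_elt p /\
  forall a b : L, a * b <= p -> ~ a * b <= phi p -> a <= p \/ b <= delta p.

(* Main.v *)
Require Import Defs.
From HB Require Import structures.
From mathcomp Require Import all_boot all_order.
From mathcomp Require Import boolp classical_sets.

(** If [a * b <= q], enlarge the factors to [a `|` q] and [b `|` q]. Expanding
their product gives [a * b], [a * q], [q * b] and [q * q], all below [q], so the
product stays below [q]; but it now dominates [q * q], so it cannot lie below
[phi q]. The weakened condition on [q] therefore applies to the enlarged pair,
and its conclusion for [a `|` q] and [b `|` q] implies the one for [a] and [b]. *)

Import Order.TTheory.

Local Open Scope order_scope.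
Local Open Scope mult_lattice_scope.

(** Distributivity over arbitrary joins, applied to the join of a pair. *)
Lemma mlmulUr (d : Order.disp_t) (L : multLatticeType d) (a x y : L) :
  a * (x `|` y) = (a * x) `|` (a * y).
Proof.
have join2 (u v : L) : u `|` v = bigjoin [set u; v]%classic.
  have [ub least] := bigjoinP [set u; v]%classic.
  apply: le_anti; apply/andP; split.
    by rewrite leUx !ub //=; [right | left].
  by apply: least => z [-> | ->]; rewrite ?leUl ?leUr.
by rewrite !join2 mlmul_bigjoin image_setU !image_set1.
Qed.

Lemma le_mlmul2l (d : Order.disp_t) (L : multLatticeType d) (a x y : L) :
  x <= y -> a * x <= a * y.
Proof. by move=> /join_r <-; rewrite mlmulUr leUl. Qed.

Lemma le_mlmul (d : Order.disp_t) (L : multLatticeType d) (a b x y : L) :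
  a <= b -> x <= y -> a * x <= b * y.
Proof.
move=> leab lexy; apply: le_trans (le_mlmul2l _ _ a _ _ lexy) _.
by rewrite mlmulC [b * y]mlmulC le_mlmul2l.
Qed.

Lemma mlmul_lel (d : Order.disp_t) (L : multLatticeType d) (a b : L) :
  a * b <= a.
Proof. by rewrite -[leRHS]mlmul1x mlmulC le_mlmul ?lex1. Qed.

Lemma mlmul_ler (d : Order.disp_t) (L : multLatticeType d) (a b : L) :
  a * b <= b.
Proof. by rewrite mlmulC mlmul_lel. Qed.

Theorem theorem2p30 (d : Order.disp_t) (L : multLatticeType d)
    (Lcg : compactly_generated L)
    (compact1 : compact_elt (\top : L))
    (compactM : compact_prod_closed L)
    (delta : L -> L) (delta_exp : expansion_function delta)
    (phi : L -> L) (phi_le : forall a : L, phi a <= a)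
    (q : L) (q_proper : proper_elt q)
    (q_primary : phi_delta_primary phi delta q)
    (q2 : ~ q ^+ 2 <= phi q) :
  delta_primary delta q.
Proof.
split=> // a b leab.
have leq : (a `|` q) * (b `|` q) <= q.
  rewrite mlmulUr [X in X `|` _]mlmulC mlmulUr !leUx mlmulC leab.
  by rewrite !mlmul_ler.
have nle : ~ (a `|` q) * (b `|` q) <= phi q.
  by move=> /(le_trans (le_mlmul _ _ _ _ _ _ (leUr q a) (leUr q b))).
have [_ /(_ _ _ leq nle)] := q_primary.
by rewrite !leUx => -[/andP[? _] | /andP[? _]]; [left | right].
Qed.
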